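(* Let $k$ be a positive integer and let $D$ be a digraph with $D\in\mathcal{L}$ and $\ell_s(D)>0$. Then either $\ell_s(D)\ge k$ or the underlying undirected graph $UN(D)$ of $D$ has pathwidth at most $k^3$.
   Context: Digraphs are finite, without loops or parallel arcs. An out-tree of a digraph $D$ is a subdigraph $T$ that is an oriented tree with exactly one vertex of in-degree zero (the root); its leaves are its vertices of out-degree zero. An out-branching of $D$ is an out-tree $T$ with $V(T)=V(D)$. $\ell(D)$ denotes the maximum number of leaves of an out-tree of $D$, and $\ell_s(D)$ the maximum number of leaves of an out-branching of $D$, with $\ell_s(D)=0$ if $D$ has no out-branching. $\mathcal{L}$ is the family of digraphs $D$ for which either $\ell_s(D)=0$ or $\ell_s(D)=\ell(D)$. The underlying undirected graph $UN(D)$ is obtained from $D$ by forgetting arc orientations and replacing each resulting pair of parallel edges by a single edge. A path decomposition of a graph $G$ is a sequence $(X_1,\dots,X_r)$ of subsets of $V(G)$ whose union is $V(G)$, such that every edge has both endpoints in some $X_i$, and for every vertex $v$ the indices $i$ with $v\in X_i$ form an interval; its width is $\max_i |X_i|-1$, and the pathwidth of $G$ is the minimum width of a path decomposition of $G$. *)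

(* Defs.v *)
From mathcomp Require Import all_boot.
From mathcomp Require Import boolp.

Set Implicit Arguments.
Unset Strict Implicit.
Unset Printing Implicit Defensive.

(* Antiparallel arcs (2-cycles) are allowed; parallel arcs are excluded by
   using a relation. *)
Record digraph := Digraph {
  vertex :> finType;
  arc : rel vertex;
  arc_irr : irreflexive arc }.

Record sgraph := SGraph {
  svertex :> finType;
  edge : rel svertex;
  edge_sym : symmetric edge;
  edge_irr : irreflexive edge }.

Definition und (T : Type) (e : rel T) : rel T := fun x y => e x y || e y x.

Lemma und_sym (T : Type) (e : rel T) : symmetric (und e).
Proof. by move=> x y; rewrite /und orbC. Qed.

Lemma und_irr (T : Type) (e : rel T) : irreflexive e -> irreflexive (und e).
Proof. by move=> e_irr x; rewrite /und e_irr. Qed.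

Definition UN (D : digraph) : sgraph :=
  SGraph (und_sym (@arc D)) (und_irr (@arc_irr D)).

Section Trees.
Variable T : finType.
Implicit Types (V : {set T}) (A : {set T * T}).

(* A cycle is a duplicate-free closed walk on at least three vertices; its
   length is at most #|T|, hence the bound, which acyclicP removes. *)
Definition acyclic (e : rel T) : bool :=
  [forall n : 'I_#|T|.+1, forall c : n.-tuple T, ucycleb e c ==> (n <= 2)].

Lemma acyclicP (e : rel T) :
  reflect (forall c : seq T, ucycle e c -> size c <= 2) (acyclic e).
Proof.
apply: (iffP forallP) => [acy c cyc_c | acy n].
- have le_c : size c < #|T|.+1 by rewrite ltnS -(card_uniqP (ucycle_uniq cyc_c)) max_card.
  by have /forallP/(_ (in_tuple c))/implyP/(_ cyc_c) := acy (Ordinal le_c).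
- by apply/forallP => c; apply/implyP => /acy; rewrite size_tuple.
Qed.

Definition is_tree V (e : rel T) : bool :=
  [&& V != set0,
      [forall x, forall y, e x y ==> (x \in V) && (y \in V)],
      [forall x in V, forall y in V, connect e x y]
    & acyclic e].

Definition arcs_rel A : rel T := fun x y => (x, y) \in A.

Definition oriented_tree V A : bool :=
  [forall x, forall y, arcs_rel A x y ==> ~~ arcs_rel A y x]
  && is_tree V (und (arcs_rel A)).

Definition indeg A (v : T) : nat := #|[set u | (u, v) \in A]|.
Definition outdeg A (v : T) : nat := #|[set u | (v, u) \in A]|.

End Trees.

Section OutTrees.
Variable D : digraph.

(* Candidate subdigraphs: a vertex set and an arc set. *)
Definition subdg : finType := ({set D} * {set D * D})%type.

Definition is_subdigraph (H : subdg) : bool :=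
  [forall a in H.2, [&& arc a.1 a.2, a.1 \in H.1 & a.2 \in H.1]].

Definition sources (H : subdg) : {set D} := [set v in H.1 | indeg H.2 v == 0].
Definition leaves (H : subdg) : {set D} := [set v in H.1 | outdeg H.2 v == 0].

Definition out_tree (H : subdg) : bool :=
  [&& is_subdigraph H, oriented_tree H.1 H.2 & #|sources H| == 1].

Definition out_branching (H : subdg) : bool :=
  out_tree H && (H.1 == [set: D]).

Definition ell : nat := \max_(H : subdg | out_tree H) #|leaves H|.

(* The maximum over the empty family is 0, the convention for digraphs
   without out-branching. *)
Definition ell_s : nat := \max_(H : subdg | out_branching H) #|leaves H|.

Definition family_L : Prop := ell_s = 0 \/ ell_s = ell.

End OutTrees.

Section Pathwidth.
Variable G : sgraph.

Definition path_decomposition (X : seq {set G}) : Prop :=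
  [/\ \bigcup_(B <- X) B = [set: G],
      (forall x y : G, edge x y ->
         exists i, [/\ i < size X, x \in nth set0 X i & y \in nth set0 X i])
    & (forall (v : G) i j l, i <= j -> j <= l -> l < size X ->
         v \in nth set0 X i -> v \in nth set0 X l -> v \in nth set0 X j)].

(* The truncated predecessor matters only for the graph without vertices,
   whose width is 0 here instead of -1. *)
Definition pd_width (X : seq {set G}) : nat := (\max_(B <- X) #|B|).-1.

Definition has_pd_of_width (w : nat) : Prop :=
  exists2 X : seq {set G}, path_decomposition X & pd_width X = w.

Lemma ex_pd_width : exists w, `[< has_pd_of_width w >].
Proof.
exists (pd_width [:: [set: G]]); apply/asboolP.
exists [:: [set: G]] => //; split; first by rewrite big_seq1.
- by move=> x y _; exists 0; rewrite /= !inE.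
- by move=> v i j [|//] _ jl _ _ _; move: jl; rewrite leqn0 => /eqP->; rewrite inE.
Qed.

Definition pathwidth : nat := ex_minn ex_pd_width.

End Pathwidth.

(* Main.v *)
From mathcomp Require Import all_boot.
From mathcomp Require Import boolp zify.
(* Imported last because [path.arc] would otherwise hide [Defs.arc]. *)
Require Import Defs.

Set Implicit Arguments.
Unset Strict Implicit.
Unset Printing Implicit Defensive.

(** Let [r] be the root of an out-branching and let [d] be the distance from
    [r], with layers [L_i].  The breadth-first tree cut off at depth [i] has
    [L_i] among its leaves, so [#|L_i| <= ell D].  An arc raises [d] by at most
    one, so only arcs jumping backwards can be long.  Let [H_i] be the set of
    heads in [L_0 .. L_(i-1)] of arcs with tail at depth at least [i].  Each
    such tail descends in the breadth-first tree from some vertex of [L_i], and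
    the heads whose tail descends from a given [w] can be hung as leaves on the
    subtree below [w]; hence [#|H_i| <= (ell D)^2].  The bags
    [L_(i-1) :|: L_i :|: H_i] form a path decomposition. *)

(** * Out-trees built from a parent function *)

Section ParentTree.
Variables (D : digraph) (V : {set D}) (r : D) (p : D -> D) (rk : D -> nat).
Hypothesis rV : r \in V.
(** The strict drop of [rk] makes iterated parents end at [r] and excludes cycles; [rk] may differ
    from the depth. *)
Hypothesis pV : forall v, v \in V -> v != r ->
  [/\ p v \in V, arc (p v) v & rk (p v) < rk v].

Definition parent_tree : subdg D := (V, [set (p v, v) | v in V :\ r]).

Lemma parent_treeE x y :
  ((x, y) \in parent_tree.2) = [&& y \in V, y != r & x == p y].
Proof.
apply/imsetP/and3P => [[v] | [yV yr /eqP ->]].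
- by rewrite !inE => /andP[vr vV] [-> ->]; rewrite eqxx.
- by exists y; rewrite // !inE yr.
Qed.

Let e := und (arcs_rel parent_tree.2).

Lemma parent_tree_edgeP x y : e x y ->
  [/\ x \in V, y \in V &
      (x = p y /\ rk x < rk y) \/ (y = p x /\ rk y < rk x)].
Proof.
rewrite /e /und /arcs_rel !parent_treeE => /orP[] /and3P[vV vr /eqP ->].
- by have [pvV _ lt_rk] := pV vV vr; split=> //; left.
- by have [pvV _ lt_rk] := pV vV vr; split=> //; right.
Qed.

(* On a cycle, both neighbours of a vertex of maximal rank would be its
   parent. *)
Lemma parent_tree_acyclic : acyclic e.
Proof.
apply/acyclicP => c /andP[cyc_c uniq_c]; rewrite leqNgt; apply/negP => lt2c.
have [x0 x0c] : exists x, x \in c.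
  by case: c lt2c {cyc_c uniq_c} => // x c; exists x; rewrite inE eqxx.
have [x xc xmax] : exists2 x, x \in c & forall y, y \in c -> rk y <= rk x.
  by case: (@arg_maxnP _ x0 (mem c) rk x0c) => x xc xmax; exists x.
have [i s def_s] := rot_to xc.
have mem_s : x :: s =i c by move=> y; rewrite -def_s mem_rot.
(* Rotated to start at [x], the cycle reads [x, y, ..., z], so [y] and [z] are the distinct
   neighbours of [x]. *)
move: cyc_c uniq_c lt2c; rewrite -(rot_cycle i) -(rot_uniq i) -(size_rot i) def_s.
case: s mem_s {def_s} => [|y s] mem_s //; case/lastP: s mem_s => [|s z] mem_s //.
rewrite /= rcons_path last_rcons => /andP[exy /andP[_ ezx]] /and3P[_ ynz _] _.
have yc : y \in c by rewrite -mem_s !inE eqxx orbT.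
have zc : z \in c by rewrite -mem_s !inE mem_rcons inE eqxx !orbT.
have [_ _ [[_ lt_xy]|[yE _]]] := parent_tree_edgeP exy.
  by move: (xmax y yc); rewrite leqNgt lt_xy.
have [_ _ [[zE _]|[_ lt_xz]]] := parent_tree_edgeP ezx; last first.
  by move: (xmax z zc); rewrite leqNgt lt_xz.
by move: ynz; rewrite yE -zE mem_rcons inE eqxx.
Qed.

Lemma parent_tree_connect v : v \in V -> connect e r v.
Proof.
have [n] := ubnP (rk v); elim: n v => // n IHn v lt_vn vV.
have [-> | vr] := eqVneq v r; first exact: connect0.
have [pvV _ lt_rk] := pV vV vr.
apply: connect_trans (IHn (p v) _ pvV) (connect1 _).
  exact: leq_trans lt_rk lt_vn.
by rewrite /e /und /arcs_rel parent_treeE vV vr eqxx.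
Qed.

Lemma out_tree_parent_tree : out_tree parent_tree.
Proof.
apply/and3P; split.
- apply/forall_inP => -[x y]; rewrite parent_treeE /= => /and3P[yV yr /eqP ->].
  by have [-> ->] := pV yV yr; rewrite yV.
- apply/andP; split.
    apply/forallP => x; apply/forallP => y; apply/implyP.
    rewrite /arcs_rel !parent_treeE => /and3P[yV yr /eqP xE].
    apply/negP => /and3P[xV xr /eqP yE].
    have [_ _ lt_xy] := pV yV yr; have [_ _ lt_yx] := pV xV xr.
    by move: lt_xy lt_yx; rewrite -xE -yE => /ltnW; rewrite leqNgt => /negP.
  apply/and4P; split; last exact: parent_tree_acyclic.
  + by apply/set0Pn; exists r.
  + apply/forallP => x; apply/forallP => y; apply/implyP.
    by case/parent_tree_edgeP => -> ->.
  + apply/forall_inP => x xV; apply/forall_inP => y yV.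
    apply: connect_trans (parent_tree_connect yV).
    rewrite (sym_connect_sym (@und_sym _ _)); exact: parent_tree_connect.
- suff -> : sources parent_tree = [set r] by rewrite cards1.
  apply/setP => v; rewrite !inE /indeg cards_eq0; apply/andP/eqP => [[vV] | ->].
    apply: contraTeq => vr; apply/set0Pn; exists (p v).
    by rewrite inE parent_treeE vV vr eqxx.
  split=> //; apply/eqP/setP => u.
  by rewrite !inE parent_treeE eqxx andbF.
Qed.

(** Since no vertex of [S] is a parent, all of [S] are leaves of [parent_tree]. The bounds on layers
    and on back heads both come from this, with different parent functions. *)
Lemma card_childless_le_ell (S : {set D}) :
  S \subset V -> (forall v, v \in V -> v != r -> p v \notin S) -> #|S| <= ell D.
Proof.
move=> /subsetP sSV noS.
have leL : #|leaves parent_tree| <= ell D.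
  exact: (@leq_bigmax_cond _ (@out_tree D) (fun H => #|leaves H|)) out_tree_parent_tree.
apply: leq_trans leL; apply/subset_leq_card/subsetP => s sS.
rewrite !inE (sSV s sS) /outdeg cards_eq0 /=; apply/eqP/setP => u.
rewrite !inE parent_treeE; apply/negP => /and3P[uV ur /eqP sE].
by move: (noS u uV ur); rewrite -sE sS.
Qed.

End ParentTree.

(** * Reachability from a root and breadth-first distance *)

Lemma out_branching_root (D : digraph) (H : subdg D) :
  out_branching H -> exists r : D, forall v, connect (@arc D) r v.
Proof.
case/andP => /and3P[/forall_inP subH /andP[asym tree] /cards1P[r srcE]] /eqP VT.
have {}asym x y : (x, y) \in H.2 -> (y, x) \in H.2 -> False.
  by move=> xy yx; move/forallP: asym => /(_ x)/forallP/(_ y)/implyP/(_ xy)/negP.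
have /and4P[_ _ _ /acyclicP acy] := tree.
pose a := arcs_rel H.2.
(* Closing the path with the arc gives an undirected cycle, so it has at most two vertices: a loop
   or two opposite arcs, both excluded by [asym]. *)
have no_cycle u u' : a u' u -> connect a u u' -> False.
  move=> au'u /connectP[q0 path_q0 last_q0].
  case/shortenP: path_q0 last_q0 => q path_q uniq_q _ u'E.
  have cyc : ucycle (und a) (u :: q).
    apply/andP; split=> //=; rewrite rcons_path; apply/andP; split.
      by apply: sub_path path_q => x y; rewrite /und => ->.
    by rewrite -u'E /und au'u.
  move: (acy _ cyc) path_q u'E au'u.
  case: q {cyc uniq_q} => [|y [|//]] _ /=.
    by move=> _ -> auu; exact: (asym _ _ auu auu).
  by rewrite andbT => auy -> ayu; exact: (asym _ _ auy ayu).
exists r => v.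
(* An ancestor of [v] with fewest ancestors is a source: by [no_cycle], an in-neighbour would lose
   [u] and so have strictly fewer. *)
pose anc u := #|[set x | connect a x u]|.
have [u uv umin] : exists2 u, connect a u v &
    forall w, connect a w v -> anc u <= anc w.
  case: (@arg_minnP _ v (fun u => connect a u v) anc (connect0 _ _)) => u uv umin.
  by exists u.
suff ur : u = r.
  move: uv; rewrite ur; apply: connect_sub => x y axy.
  by apply: connect1; have /and3P[] := subH _ axy.
apply/set1P; rewrite -srcE inE VT inE /indeg cards_eq0 /=.
apply/negPn/negP => /set0Pn[u']; rewrite inE => au'u.
move: (umin u' (connect_trans (connect1 au'u) uv)); apply/negP; rewrite -ltnNge.
apply/proper_card/properP; split.
  apply/subsetP => x; rewrite !inE => xu'.
  exact: connect_trans xu' (connect1 au'u).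
exists u; rewrite !inE ?connect0 //; apply/negP; exact: no_cycle au'u.
Qed.

Lemma bfs_exists (T : finType) (e : rel T) (r : T) :
    (forall v, connect e r v) ->
  exists (d : T -> nat) (p : T -> T),
    (forall v, v != r -> e (p v) v /\ d v = (d (p v)).+1)
    /\ (forall x y, e x y -> d y <= (d x).+1).
Proof.
move=> conn.
pose walk v n := [exists q : n.-tuple T, path e r q && (last r q == v)].
have walkP v n : reflect (exists q, [/\ path e r q, last r q = v & size q = n])
                         (walk v n).
  apply: (iffP existsP) => [[q /andP[pq /eqP lq]] | [q [pq lq <-]]].
    by exists q; rewrite size_tuple.
  by exists (in_tuple q); rewrite pq lq eqxx.
have ex_walk v : exists n, walk v n.
  have /connectP[q pq vE] := conn v.
  by exists (size q); apply/walkP; exists q.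
pose d v := ex_minn (ex_walk v).
have d_walk v : walk v (d v) by rewrite /d; case: ex_minnP.
have d_min v n : walk v n -> d v <= n by rewrite /d; case: ex_minnP => m _; apply.
have d_arc x y : e x y -> d y <= (d x).+1.
  move=> exy; apply: d_min; have /walkP[q [pq lq sq]] := d_walk x.
  apply/walkP; exists (rcons q y).
  by rewrite rcons_path last_rcons size_rcons pq lq sq.
(* For [v != r] the [pick] succeeds: the last but one vertex of a shortest walk to [v] qualifies. *)
pose p v := odflt r [pick x | e x v && (d v == (d x).+1)].
exists d, p; split=> // v vr; rewrite /p; case: pickP => [x /andP[-> /eqP] // | none].
have /walkP[q [pq lq sq]] := d_walk v.
case/lastP: q pq lq sq => [_ /= rv | q y]; first by rewrite rv eqxx in vr.
rewrite rcons_path last_rcons size_rcons => /andP[pq ey] yv sq; subst y.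
move: (none (last r q)); rewrite ey eqn_leq d_arc //= -sq ltnS.
by rewrite d_min //; apply/walkP; exists q.
Qed.

(** * Bounds on layers and back heads *)

Section Layers.
Variables (D : digraph) (r : D) (d : D -> nat) (p : D -> D).
Hypothesis parentP : forall v, v != r -> arc (p v) v /\ d v = (d (p v)).+1.
Hypothesis d_arc : forall x y : D, arc x y -> d y <= (d x).+1.

Definition layer i : {set D} := [set v | d v == i].
Definition back_heads i : {set D} :=
  [set u | (d u < i) && [exists v, (i <= d v) && arc v u]].

Lemma root_le v : d r <= d v.
Proof.
have [n] := ubnP (d v); elim: n v => // n IHn v.
have [-> // | vr] := eqVneq v r; have [_ ->] := parentP vr.
by rewrite ltnS => /IHn/leqW.
Qed.

Lemma card_layer i : #|layer i| <= ell D.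
Proof.
(* A vertex of the layer yields [d r <= i], so the truncated tree contains its root. *)
have [->|[v0]] := set_0Vmem (layer i); first by rewrite cards0.
rewrite inE => /eqP dv0.
apply: (@card_childless_le_ell D [set v | d v <= i] r p d).
- by rewrite inE -dv0 root_le.
- move=> v; rewrite inE => dv vr; have [a_v dE] := parentP vr.
  by rewrite inE a_v; split=> //; lia.
- by apply/subsetP => v; rewrite !inE => /eqP->.
- move=> v; rewrite inE => dv vr; have [a_v dE] := parentP vr.
  by rewrite inE; lia.
Qed.

(** One arc is fixed for each back head; the default [u] never occurs on [back_heads i]. *)
Definition tail i u : D := odflt u [pick v | (i <= d v) && arc v u].

Lemma tailP i u : u \in back_heads i -> i <= d (tail i u) /\ arc (tail i u) u.
Proof.
rewrite inE /tail => /andP[_ /existsP[v]]; case: pickP => [w /andP[] // | none].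
by rewrite none.
Qed.

(* Meaningful only when [i <= d v]. *)
Definition ancestor i v : D := iter (d v - i) p v.

Lemma ancestor_parent i v : v != r -> i < d v -> ancestor i (p v) = ancestor i v.
Proof.
move=> vr lt_iv; have [_ dE] := parentP vr; rewrite /ancestor.
by rewrite (_ : d v - i = (d (p v) - i).+1) ?iterSr //; lia.
Qed.

Lemma d_ancestor i v : d r <= i -> i <= d v -> d (ancestor i v) = i.
Proof.
move=> le_ri; have [n] := ubnP (d v); elim: n v => // n IHn v lt_vn.
rewrite leq_eqVlt => /orP[/eqP iE | lt_iv].
  by rewrite /ancestor -iE subnn.
have vr : v != r by apply: contraTneq lt_iv => ->; rewrite -leqNgt.
have [_ dE] := parentP vr.
by rewrite -ancestor_parent // IHn //; lia.
Qed.

Definition back_heads_below i w : {set D} :=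
  [set u in back_heads i | ancestor i (tail i u) == w].

(** The out-tree is rooted at [w]: descendants of [w] keep their parent [p], and each head in [S]
    hangs from its chosen tail. All parents have depth at least [i] and heads have depth below [i],
    so heads are leaves. *)
Lemma card_back_heads_below i w : w \in layer i -> #|back_heads_below i w| <= ell D.
Proof.
rewrite inE => /eqP dw.
pose S := back_heads_below i w.
pose V := [set v | (i <= d v) && (ancestor i v == w)] :|: S.
pose q v := if v \in S then tail i v else p v.
(* The vertices of [S] are leaves, so they get a rank above all others. *)
pose rk v := if v \in S then (\max_v d v).+1 else d v.
have S_lt v : v \in S -> d v < i by rewrite !inE => /andP[/andP[]].
have ge_nS v : i <= d v -> v \in S = false.
  by move=> le_iv; apply/negP => /S_lt; rewrite ltnNge le_iv.
have memV v : (v \in V) = (i <= d v) && (ancestor i v == w) || (v \in S).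
  by rewrite in_setU inE.
have step v : v \in V -> v != w ->
    [/\ q v \in V, arc (q v) v, i <= d (q v) & rk (q v) < rk v].
  rewrite !memV /q /rk => vV vw.
  have [vS | vNS] := boolP (v \in S).
    move: (vS); rewrite inE => /andP[vH /eqP tw]; have [le_it at_] := tailP vH.
    rewrite le_it tw eqxx (ge_nS _ le_it) ltnS; split=> //.
    exact: leq_bigmax.
  move: vV; rewrite (negbTE vNS) orbF => /andP[le_iv /eqP vE].
  (* At depth exactly [i], [v] would be its own ancestor, that is [w]. *)
  have lt_iv : i < d v.
    rewrite ltn_neqAle le_iv andbT; apply: contraNneq vw => iE.
    by rewrite -vE /ancestor -iE subnn.
  have vr : v != r.
    by apply: contraTneq lt_iv => ->; rewrite -leqNgt -dw root_le.
  have [a_v dE] := parentP vr; have le_ip : i <= d (p v) by lia.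
  by rewrite ancestor_parent // vE eqxx le_ip (ge_nS _ le_ip) a_v dE.
apply: (@card_childless_le_ell D V w q rk).
- by rewrite memV dw leqnn /ancestor dw subnn eqxx.
- by move=> v vV vw; have [] := step v vV vw.
- exact: subsetUr.
- by move=> v vV vw; have [_ _ le_iq _] := step v vV vw; rewrite -/S ge_nS.
Qed.

Lemma card_back_heads i : #|back_heads i| <= ell D * ell D.
Proof.
(* As [d r] is the least depth, there are no heads of depth below [i] when [i < d r]; otherwise
   ancestors at depth [i] exist. *)
have [lt_ir | le_ri] := ltnP i (d r).
  suff -> : back_heads i = set0 by rewrite cards0.
  by apply/setP => u; rewrite !inE; have := root_le u; case: ltnP => //=; lia.
have sub : back_heads i \subset \bigcup_(w in layer i) back_heads_below i w.
  apply/subsetP => u uH; have [le_it _] := tailP uH.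
  apply/bigcupP; exists (ancestor i (tail i u)); first by rewrite inE d_ancestor.
  by rewrite inE uH eqxx.
apply: leq_trans (subset_leq_card sub) _.
apply: (@leq_trans (\sum_(w in layer i) #|back_heads_below i w|)).
  elim/big_rec2: _ => [|w n B _ le_Bn]; first by rewrite cards0.
  by apply: leq_trans (leq_card_setU _ _) _; rewrite leq_add2l.
apply: (@leq_trans (\sum_(w in layer i) ell D)).
  by apply: leq_sum => w; exact: card_back_heads_below.
by rewrite sum_nat_const leq_mul2r card_layer orbT.
Qed.

(** * The path decomposition *)

Definition bag i : {set UN D} :=
  [set v | (d v).+1 == i] :|: layer i :|: back_heads i.

Lemma card_bag i : #|bag i| <= ell D * ell D + 2 * ell D.
Proof.
have prev : #|[set v : D | (d v).+1 == i]| <= ell D.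
  (* At [i = 0] the preceding layer is empty, as [(d v).+1] is never 0. *)
  case: i => [|i]; last exact: card_layer.
  by rewrite (_ : finset _ = set0) ?cards0 //; apply/setP => v; rewrite !inE.
apply: leq_trans (leq_card_setU _ _) _; rewrite addnC.
apply: leq_add (card_back_heads i) _; rewrite mul2n -addnn.
exact: leq_trans (leq_card_setU _ _) (leq_add prev (card_layer i)).
Qed.

Lemma mem_bag i (v : D) : (v \in bag i) =
  [|| (d v).+1 == i, d v == i
    | (d v < i) && [exists w, (i <= d w) && arc w v]].
Proof. by rewrite !inE orbA. Qed.

Definition layer_bags : seq {set UN D} := mkseq bag (\max_v d v).+1.

Lemma layer_bags_pd : path_decomposition layer_bags.
Proof.
have sz (v : D) : d v < size layer_bags by rewrite size_mkseq ltnS leq_bigmax.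
have nthE i : i < size layer_bags -> nth set0 layer_bags i = bag i.
  by rewrite size_mkseq => lt_i; rewrite nth_mkseq.
have arc_bag (x y : D) : arc x y -> exists i,
    [/\ i < size layer_bags, x \in nth set0 layer_bags i
      & y \in nth set0 layer_bags i].
  move=> axy; have le_yx := d_arc axy.
  (* A backward arc lies in the bag of its tail, with [y] as a back head. Otherwise [x] is in the
     layer of [y] or the one before, and the bag of [y] serves. *)
  have [lt_yx | le_xy] := ltnP (d y) (d x).
    exists (d x); rewrite nthE // !mem_bag eqxx orbT lt_yx; split=> //=.
    by apply/or3P/Or33/existsP; exists x; rewrite leqnn.
  exists (d y); rewrite nthE // !mem_bag eqxx orbT; split=> //.
  have [->|neq] := eqVneq (d x) (d y); first by rewrite orbT.
  by apply/or3P/Or31; lia.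
split.
- apply/setP => v; rewrite inE (big_rem (bag (d v))) /=; last first.
    by rewrite -nthE ?mem_nth.
  by rewrite inE mem_bag eqxx orbT.
- move=> x y /orP[/arc_bag // | /arc_bag[i [? ? ?]]]; by exists i.
- move=> v i j l le_ij le_jl lt_l.
  rewrite !nthE; try lia; rewrite !mem_bag.
  have [->|nvj] := eqVneq (d v) j; first by rewrite orbT.
  have [->|nvj'] := eqVneq (d v).+1 j; first by [].
  (* Now [v] can only be in bags [j] and [l] as a back head, and a tail at depth at least [l] is
     also at depth at least [j]. *)
  move=> vi vl /=.
  have lt_vj : d v < j by case/or3P: vi => [||/andP[]]; lia.
  rewrite lt_vj; case/or3P: vl => [||/andP[_ /existsP[w /andP[le_w awv]]]]; try lia.
  by apply/existsP; exists w; rewrite awv andbT; lia.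
Qed.

End Layers.

(** * From bag sizes to the pathwidth bound *)

Lemma pathwidth_le (G : sgraph) (X : seq {set G}) (w : nat) :
  path_decomposition X -> (forall B, B \in X -> #|B| <= w.+1) -> pathwidth G <= w.
Proof.
move=> pdX le_w; rewrite /pathwidth; case: ex_minnP => m _ min_m.
apply: (@leq_trans (pd_width X)); first by apply: min_m; apply/asboolP; exists X.
rewrite /pd_width -subn1 leq_subLR add1n.
by apply/bigmax_leqP_seq => B BX _; exact: le_w.
Qed.

Theorem theorem4p1 (k : nat) (D : digraph) (k_gt0 : 0 < k)
    (DL : family_L D) (ls_gt0 : 0 < ell_s D) :
  k <= ell_s D \/ pathwidth (UN D) <= k ^ 3.
Proof.
have [le_k | lt_k] := leqP k (ell_s D); [by left | right].
have lt_ell : ell D < k by case: DL => [ls0 | <- //]; rewrite ls0 in ls_gt0.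
have [H brH] : exists H : subdg D, out_branching H.
  apply/existsP; apply: contraTT ls_gt0 => /existsPn noH.
  by rewrite -leqNgt; apply/bigmax_leqP => H brH; case/negP: (noH H).
have [r /bfs_exists[d [p [parentP d_arc]]]] := out_branching_root brH.
apply: (pathwidth_le (layer_bags_pd d_arc)) => B /mapP[i _ ->].
apply: leq_trans (card_bag parentP i) _.
(* The left side is [(ell D + 1) ^ 2 - 1], and [ell D + 1 <= k]. *)
have le_sq : ell D * ell D + 2 * ell D <= k ^ 2 by nia.
apply: leq_trans le_sq (leqW _).
exact: leq_pexp2l.
Qed.
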